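(* Let $0<p<\infty$ and $0<q<r\le\infty$. Then there is $\alpha>0$ such that for all $n\in\mathbb{N}$ the $n$-th Bernstein number of the inclusion map $\mathrm{id}:\ell_{p,q}\hookrightarrow\ell_{p,r}$ satisfies $b_n(\mathrm{id}:\ell_{p,q}\hookrightarrow\ell_{p,r})\ge\alpha$.
   Context: Sequences are real and indexed by $\mathbb{N}=\{1,2,\dots\}$. For a sequence $u$ its non-increasing rearrangement is $u^*(j)=\inf\{\lambda\ge 0:\ \#\{i:|u(i)|>\lambda\}\le j-1\}$ for $j\in\mathbb{N}$ (with $\inf\emptyset=\infty$). For $0<p<\infty$ and $0<q\le\infty$ put $$\|u\|_{p,q}=\Big(\sum_{j=1}^\infty j^{q/p-1}(u^*(j))^q\Big)^{1/q}\ \text{ if } q<\infty,\qquad \|u\|_{p,\infty}=\sup_{j\ge1} j^{1/p}u^*(j).$$ The Lorentz sequence space $\ell_{p,q}$ consists of all real sequences $u$ with $\|u\|_{p,q}<\infty$; it is a quasi-Banach space under $\|\cdot\|_{p,q}$, and for $q<r$ one has $\ell_{p,q}\subset\ell_{p,r}$ with bounded inclusion. For a bounded linear map $T:X\to Y$ between (quasi-)Banach spaces, the $n$-th Bernstein number is $$b_n(T)=\sup_{E\subset X,\ \dim E=n}\ \inf_{f\in E,\ \|f\|_X=1}\|T(f)\|_Y,$$ the supremum being over all $n$-dimensional linear subspaces $E$ of $X$. (An operator $T$ is finitely strictly singular if and only if $b_n(T)\to0$.) *)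

(* Defs.v *)
From HB Require Import structures.
From mathcomp Require Import all_boot all_order all_algebra.
From mathcomp Require Import all_classical all_reals all_analysis.
Set Implicit Arguments.
Unset Strict Implicit.
Unset Printing Implicit Defensive.
Import Order.TTheory GRing.Theory Num.Theory.
Import numFieldNormedType.Exports.
Local Open Scope classical_set_scope.
Local Open Scope ring_scope.
Local Open Scope ereal_scope.

(* The entries of a sequence u are numbered from 0 (u i is the (i+1)-st entry
   in the mathematical text, which is harmless since only the cardinality of
   level sets matters), whereas rearrangements are numbered from 1: only the
   values rearrangement u j with 1 <= j are meaningful. *)
Definition rearrangement (R : realType) (u : R^nat) (j : nat) : \bar R :=
  ereal_inf [set l%:E | l in
    [set l : R | (0 <= l)%R /\ ([set i | (l < `|u i|)%R] #<= `I_j.-1)%card]].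

(* Meaningful for 0 < p and 0 < q <= +oo; the case q = -oo is a dummy value. *)
Definition lorentz_norm (R : realType) (p : R) (q : \bar R) (u : R^nat) :
    \bar R :=
  match q with
  | s%:E => (\sum_(1 <= j <oo)
               (j%:R `^ (s / p - 1))%R%:E * rearrangement u j `^ s) `^ s^-1%R
  | +oo => ereal_sup [set (j%:R `^ p^-1)%R%:E * rearrangement u j | j in
                       [set j : nat | (1 <= j)%N]]
  | -oo => 0
  end.

Definition lorentz (R : realType) (p : R) (q : \bar R) : set (R^nat) :=
  [set u | lorentz_norm p q u < +oo].

Definition lin_indep (R : realType) (V : lmodType R) (n : nat)
    (e : 'I_n -> V) : Prop :=
  forall c : 'I_n -> R, (\sum_(i < n) c i *: e i = 0)%R -> forall i, c i = 0%R.

Definition lin_span (R : realType) (V : lmodType R) (n : nat)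
    (e : 'I_n -> V) : set V :=
  [set v | exists c : 'I_n -> R, v = (\sum_(i < n) c i *: e i)%R].

Definition subspace_of_dim (R : realType) (V : lmodType R) (n : nat)
    (E : set V) : Prop :=
  exists2 e : 'I_n -> V, lin_indep e & E = lin_span e.

(* n-th Bernstein number of T : X -> Y, where X is a linear subspace of an
   ambient vector space V, with (quasi-)norm nX, and Y is a linear subspace of
   W, with (quasi-)norm nY; the subspaces of X are those of V that are
   contained in X. *)
Definition bernstein (R : realType) (V W : lmodType R) (X : set V)
    (nX : V -> \bar R) (nY : W -> \bar R) (T : V -> W) (n : nat) : \bar R :=
  ereal_sup [set ereal_inf [set nY (T f) | f in [set f | E f /\ nX f = 1]]
            | E in [set E : set V | subspace_of_dim n E /\ E `<=` X]].

(* Main.v *)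
Require Import Defs.
From HB Require Import structures.
From mathcomp Require Import all_boot all_order all_algebra finmap.
From mathcomp Require Import all_classical all_reals all_analysis.
From mathcomp Require Import ring lra.
Set Implicit Arguments.
Unset Strict Implicit.
Unset Printing Implicit Defensive.
Import Order.TTheory GRing.Theory Num.Theory.
Import numFieldNormedType.Exports.
Local Open Scope classical_set_scope.
Local Open Scope ring_scope.

(** The subspaces E that witness the lower bound are spanned by n Rademacher
sequences supported on the first N = 2^n integers: the k-th one is
(-1)^(k-th binary digit of i) for i < N and 0 afterwards. An element
f = sum_k c_k e_k is, for the uniform probability on these N integers, a
Rademacher sum, so Khintchine's inequalities say that its distribution is
governed by sigma = sqrt (sum_k c_k^2) alone, uniformly in n:

- for all k, the mean of f^(2k) is at most (2k)! sigma^(2k)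
  ([sum_rademacher_sum_even_pow]), whence by Markov's inequality
  f^*(j) <= (C N / j)^(1/2k) sigma;

- comparing the second and the fourth moment, |f| > sigma/2 on at least N/48
  of the integers ([paley_zygmund_count]), whence f^*(j) >= sigma/2 for
  j <= N/48.

Taking 2k > p in the first estimate makes the decay j^(-1/2k) slower than the
critical j^(-1/p), so that the sum over j <= N that defines the norm is
dominated by the indices j of order N; this gives
||f||_{p,q} <= C N^(1/p) sigma ([lorentz_norm_rademacher_le]). The second
estimate gives ||f||_{p,r} >= c N^(1/p) sigma ([le_lorentz_norm_rademacher]).
On E both quasi-norms are therefore comparable to N^(1/p) sigma with constants
that do not depend on n, and alpha = c / C works. *)

(** * Moments of Rademacher sums *)

(** The sign carried by the k-th binary digit of i; over i < 2^n, the signs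
with k < n are independent and symmetric. *)
Definition rademacher (R : pzRingType) (k i : nat) : R :=
  (-1) ^+ odd (i %/ 2 ^ k).

Definition rademacher_sum (R : pzRingType) n (c : 'I_n -> R) (i : nat) : R :=
  \sum_(k < n) c k * rademacher R k i.

Lemma sum_even_odd (V : nmodType) (f : nat -> V) n :
  \sum_(i < n.*2) f i = \sum_(i < n) (f i.*2 + f i.*2.+1).
Proof.
elim: n => [|n IHn]; first by rewrite !big_ord0.
by rewrite doubleS !big_ord_recr /= IHn addrA.
Qed.

(** Splitting off the lowest binary digit: this is the induction on n behind
all the moment computations. *)
Lemma rademacher_sumS (R : pzRingType) n (c : 'I_n.+1 -> R) (b : bool) i :
  rademacher_sum c (b + i.*2) =
    c ord0 * (-1) ^+ b + rademacher_sum (c \o lift ord0) i.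
Proof.
rewrite /rademacher_sum big_ord_recl /rademacher expn0 divn1 oddD odd_double.
rewrite addbF oddb; congr (_ + _); apply: eq_bigr => k _ /=.
by rewrite /bump add1n expnS divnMA divn2 half_bit_double.
Qed.

Lemma sum_rademacher_sumS (R : pzRingType) (V : nmodType) (g : R -> V) n
    (c : 'I_n.+1 -> R) :
  \sum_(i < 2 ^ n.+1) g (rademacher_sum c i) =
  \sum_(i < 2 ^ n) (g (rademacher_sum (c \o lift ord0) i + c ord0) +
                    g (rademacher_sum (c \o lift ord0) i - c ord0)).
Proof.
rewrite expnS mul2n (sum_even_odd (fun i => g (rademacher_sum c i))).
apply: eq_bigr => i _.
have := rademacher_sumS c false i; rewrite add0n expr0 mulr1 => ->.
have := rademacher_sumS c true i; rewrite add1n expr1 mulrN1 => ->.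
by rewrite addrC [- _ + _]addrC [c _ + _]addrC addrC.
Qed.

Lemma sum_rademacher_sum_sqr (R : realDomainType) n (c : 'I_n -> R) :
  \sum_(i < 2 ^ n) rademacher_sum c i ^+ 2 = (2 ^ n)%:R * \sum_(k < n) c k ^+ 2.
Proof.
elim: n c => [|n IHn] c.
  by rewrite expn0 big_ord1 /rademacher_sum !big_ord0 expr0n mulr0.
rewrite (sum_rademacher_sumS (fun x => x ^+ 2)) big_ord_recl.
under eq_bigr => i _.
  rewrite (_ : _ + _ = (rademacher_sum (c \o lift ord0) i ^+ 2 +
                        c ord0 ^+ 2) * 2%:R); last by ring.
  over.
rewrite -mulr_suml big_split /= IHn sumr_const card_ord -mulr_natr expnS natrM.
by ring.
Qed.

Lemma exprD_exprB_even (R : comPzRingType) (x y : R) k :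
  (x + y) ^+ k.*2 + (x - y) ^+ k.*2 =
  (\sum_(l < k.+1) x ^+ (k - l).*2 * y ^+ l.*2 *+ 'C(k.*2, l.*2)) *+ 2.
Proof.
rewrite !exprDn -big_split /=.
pose f i := x ^+ (k.*2 - i) * y ^+ i *+ 'C(k.*2, i) +
            x ^+ (k.*2 - i) * (- y) ^+ i *+ 'C(k.*2, i).
rewrite -(big_mkord xpredT f) big_nat_recr //= big_mkord sum_even_odd.
rewrite big_ord_recr /= mulrnDl; congr (_ + _); last first.
  by rewrite /f -doubleB exprNn -signr_odd odd_double expr0 mul1r mulr2n.
rewrite -sumrMnl; apply: eq_bigr => i _.
rewrite /f -doubleB [(- y) ^+ i.*2]exprNn [(- y) ^+ i.*2.+1]exprNn.
rewrite -[(-1) ^+ i.*2]signr_odd odd_double expr0 mul1r.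
by rewrite -signr_odd /= odd_double expr1 mulN1r mulrN mulNrn subrr addr0.
Qed.

(** The constants (2k)! of the moment bound are chosen so that its induction
step reduces to this inequality, which holds because
'C(2k, 2l) (2l)! (2k - 2l)! = (2k)!. *)
Lemma leq_bin_double k l : (l <= k)%N ->
  ('C(k.*2, l.*2) * (k - l).*2`! <= k.*2`! * 'C(k, l))%N.
Proof.
move=> lk.
have := @bin_fact k.*2 l.*2; rewrite leq_double lk -doubleB => <- //.
rewrite -mulnA leq_mul2l; apply/orP; right.
rewrite mulnAC mulnC leq_pmulr // muln_gt0 fact_gt0 bin_gt0 lk //.
Qed.

(** Upper Khintchine inequality for even exponents. With F the sum over all
but one of the signs and y the remaining coefficient, averaging over the last
sign kills the odd terms of (F + y)^(2k); the even ones are bounded by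
induction and compared with the binomial expansion of (A + y^2)^k. *)
Lemma sum_rademacher_sum_even_pow (R : realDomainType) n (c : 'I_n -> R) k :
  \sum_(i < 2 ^ n) rademacher_sum c i ^+ k.*2 <=
    (k.*2)`!%:R * (2 ^ n)%:R * (\sum_(j < n) c j ^+ 2) ^+ k.
Proof.
elim: n c k => [|n IHn] c k.
  rewrite expn0 big_ord1 /rademacher_sum !big_ord0 mulr1.
  case: k => [|k]; first by rewrite !expr0 mulr1.
  by rewrite !expr0n /= mulr0.
rewrite (sum_rademacher_sumS (fun x => x ^+ k.*2)) big_ord_recl.
set d := c \o _; set y := c ord0.
rewrite (_ : \sum_(j < n) _ = \sum_(j < n) d j ^+ 2) //.
set A := \sum_(j < n) _.
have A0 : 0 <= A by apply: sumr_ge0 => j _; exact: sqr_ge0.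
under eq_bigr do rewrite exprD_exprB_even -mulr_natr.
rewrite -mulr_suml exchange_big /= expnS natrM [y ^+ 2 + A]addrC exprDn.
rewrite [leRHS](_ : _ = (k.*2)`!%:R * (2 ^ n)%:R *
  (\sum_(i < k.+1) A ^+ (k - i) * (y ^+ 2) ^+ i *+ 'C(k, i)) * 2%:R);
  last by ring.
rewrite ler_wpM2r // mulr_sumr; apply: ler_sum => l _.
under eq_bigr do rewrite -mulrnAr.
rewrite -mulr_suml -exprM mul2n -!mulrnAr -mulr_natr -[in leRHS]mulr_natr.
have y0 : 0 <= y ^+ l.*2 by rewrite -mul2n exprM exprn_ge0 // sqr_ge0.
apply: (@le_trans _ _ ((k - l).*2`!%:R * (2 ^ n)%:R * A ^+ (k - l) *
    (y ^+ l.*2 * 'C(k.*2, l.*2)%:R))).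
  by rewrite ler_wpM2r // mulr_ge0.
rewrite [leLHS](_ : _ = ('C(k.*2, l.*2) * (k - l).*2`!)%:R *
   ((2 ^ n)%:R * A ^+ (k - l) * y ^+ l.*2)); last by rewrite natrM; ring.
rewrite [leRHS](_ : _ = (k.*2`! * 'C(k, l))%:R *
   ((2 ^ n)%:R * A ^+ (k - l) * y ^+ l.*2)); last by rewrite natrM; ring.
rewrite ler_wpM2r ?ler_nat ?leq_bin_double -1?ltnS //.
by rewrite mulr_ge0 // mulr_ge0 // exprn_ge0.
Qed.

(** * Distribution estimates from moments *)

(** Paley-Zygmund inequality: a function whose fourth moment is controlled by
the square of its second moment cannot be small on almost all points. *)
Lemma paley_zygmund_count (R : realFieldType) N (f : 'I_N -> R) (s : R) :
  0 < s -> \sum_i f i ^+ 2 = N%:R * s ^+ 2 ->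
  \sum_i f i ^+ 4 <= 24%:R * N%:R * s ^+ 4 ->
  (N%:R : R) <= 48%:R * #|[pred i | s / 2%:R < `|f i| ]|%:R.
Proof.
move=> s0 f2 f4.
have s20 : 0 < s ^+ 2 by rewrite exprn_gt0.
(* Off the level set, f^2 is at most s^2/4; on it, the arithmetic-geometric
   mean inequality bounds f^2 by f^4 / (96 s^2) + 24 s^2. The constant 96 makes
   the fourth moment contribute N s^2 / 4, so that half of N s^2 is left for
   the points of the level set. *)
have pointwise i : f i ^+ 2 <= s ^+ 2 / 4%:R +
    (96%:R * s ^+ 2)^-1 * f i ^+ 4 + 24%:R * s ^+ 2 * (s / 2%:R < `|f i|)%R%:R.
  have p0 : 0 <= (96%:R * s ^+ 2)^-1 * f i ^+ 4.
    rewrite mulr_ge0 //; first by rewrite invr_ge0 ltW // mulr_gt0.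
    by rewrite (exprM _ 2 2) sqr_ge0.
  have [_|fs] := ltP.
    rewrite mulr1 -subr_ge0.
    have -> : s ^+ 2 / 4%:R + (96%:R * s ^+ 2)^-1 * f i ^+ 4 +
      24%:R * s ^+ 2 - f i ^+ 2 = s ^+ 2 / 4%:R +
      (96%:R * s ^+ 2)^-1 * (f i ^+ 2 - 48%:R * s ^+ 2) ^+ 2.
      by field; rewrite gt_eqF.
    rewrite addr_ge0 //; first by rewrite divr_ge0 // ltW.
    by rewrite mulr_ge0 ?sqr_ge0 // invr_ge0 ltW // mulr_gt0.
  rewrite mulr0 addr0 ler_wpDr //.
  rewrite -[f i ^+ 2]real_normK ?num_real //.
  rewrite (le_trans (y := (s / 2%:R) ^+ 2)) //.
    by rewrite lerXn2r ?nnegrE // divr_ge0 // ltW.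
  by rewrite expr_div_n -natrX.
have := @ler_sum _ _ (index_enum 'I_N) xpredT _ _ (fun i _ => pointwise i).
rewrite f2 !big_split /=.
rewrite sumr_const card_ord -!mulr_sumr.
have -> : \sum_i (s / 2%:R < `|f i|)%R%:R =
          #|[pred i | (s / 2%:R < `|f i|)%R]|%:R :> R.
  by rewrite -natr_sum -big_mkcond sum1_card.
move: (#|_|) => c H.
have f4' : (96%:R * s ^+ 2)^-1 * \sum_i f i ^+ 4 <= N%:R * s ^+ 2 / 4%:R.
  rewrite mulrC ler_pdivrMr ?mulr_gt0 // (le_trans f4) // le_eqVlt.
  by apply/orP; left; apply/eqP; field.
rewrite -(ler_pM2r s20); move: H; rewrite -mulr_natl.
move: f4' => /[swap]. lra.
Qed.

(** Markov's inequality, in the strict form needed for rearrangements. *)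
Lemma count_lt_of_sum_pow (R : realDomainType) N (f : 'I_N -> R) (l : R) k j :
  (0 < k)%N -> (0 < j)%N -> 0 <= l ->
  \sum_i f i ^+ k.*2 <= j%:R * l ^+ k.*2 ->
  (#|[pred i | (l < `|f i|)%R]| < j)%N.
Proof.
move=> k0 j0 l0 H; rewrite ltnNge; apply/negP => jc.
have f0 i : 0 <= f i ^+ k.*2 by rewrite -mul2n exprM exprn_ge0 // sqr_ge0.
suff : j%:R * l ^+ k.*2 < \sum_i f i ^+ k.*2 by rewrite ltNge H.
apply: (@lt_le_trans _ _ (\sum_(i | l < `|f i|) f i ^+ k.*2)); last first.
  by rewrite [leRHS](bigID (fun i => l < `|f i|)) /= lerDl sumr_ge0.
apply: (@le_lt_trans _ _ (\sum_(i | l < `|f i|) l ^+ k.*2)).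
  by rewrite sumr_const -[leRHS]mulr_natl ler_wpM2r ?exprn_ge0 // ler_nat.
have : (0 < #|[pred i | (l < `|f i|)%R]|)%N by exact: leq_trans jc.
case/card_gt0P => i0 i0P; apply: ltr_sum.
  by apply/hasP; exists i0 => //; rewrite mem_index_enum.
move=> i li; rewrite -[f i ^+ _]ger0_norm // normrX.
by rewrite ltrXn2r ?double_eq0 -?lt0n ?nnegrE.
Qed.

(** * Sums of powers *)

(** Young's inequality for x^g and 1. *)
Lemma bernoulli_powR (R : realType) (x g : R) :
  0 <= x -> 0 < g <= 1 -> x `^ g <= 1 + g * (x - 1).
Proof.
move=> x0 /andP[g0]; rewrite le_eqVlt => /orP[/eqP ->|g1].
  by rewrite powRr1 // mul1r addrC subrK.
have := @conjugate_powR R (x `^ g) 1 g^-1 (1 - g)^-1 (powR_ge0 _ _) ler01.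
rewrite !invr_gt0 subr_gt0 !invrK => /(_ g0 g1).
rewrite -powRrM divff ?gt_eqF // powRr1 // powR1 mulr1.
by rewrite addrC subrK => /(_ erefl); lra.
Qed.

(** For g < 1 the sum telescopes, as g j^(g-1) <= j^g - (j-1)^g by concavity;
for g >= 1 each term is at most the last one. *)
Lemma sum_powR_ub (R : realType) (g : R) : 0 < g ->
  exists2 C : R, 0 < C & forall N : nat,
  \sum_(1 <= j < N.+1) (j%:R : R) `^ (g - 1) <= C * N%:R `^ g.
Proof.
move=> g0; have [g1|g1] := leP 1%R g.
  exists 1%R => // N; rewrite mul1r.
  apply: (@le_trans _ _ (\sum_(1 <= j < N.+1) N%:R `^ (g - 1))).
    apply: ler_sum_nat => j /andP[_ jN].
    by rewrite ge0_ler_powR ?nnegrE ?subr_ge0 // ler_nat -ltnS.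
  rewrite sumr_const_nat subn1 -[leLHS]mulr_natl.
  case: N => [|N]; first by rewrite mul0r powR_ge0.
  by rewrite mulr_powRB1.
exists g^-1; first by rewrite invr_gt0.
elim=> [|N IH]; first by rewrite big_geq // mulr_ge0 ?powR_ge0 ?invr_ge0 ?ltW.
rewrite big_nat_recr //= -lerBrDr (le_trans IH) // lerBrDr -lerBrDl.
rewrite -mulrBr mulrC ler_pdivlMr //.
have N0 : (0 < N.+1%:R :> R) by [].
have : ((N%:R / N.+1%:R) `^ g <= 1 - g / N.+1%:R).
  have := @bernoulli_powR R (N%:R / N.+1%:R) g.
  rewrite divr_ge0 // g0 ltW // => /(_ isT isT) /le_trans; apply.
  rewrite le_eqVlt; apply/orP; left; apply/eqP.
  by rewrite -[N.+1]addn1 natrD; field; rewrite ?natr1 ?nat1r pnatr_eq0.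
rewrite -(ler_pM2r (powR_gt0 g N0)) -powRM ?divr_ge0 //.
rewrite divfK ?gt_eqF // mulrBl mul1r -mulrA.
rewrite -{2}(mulr_powRB1 (ltW N0) g0) mulKf ?gt_eqF //.
by rewrite lerBrDr addrC -lerBrDr mulrC.
Qed.

(** For b <= 1 each term is at least the last one; for b > 1 the upper half of
the indices already gives the right order of magnitude. *)
Lemma sum_powR_lb (R : realType) (b : R) : 0 < b ->
  exists2 C : R, 0 < C & forall M : nat, (0 < M)%N ->
  C * M%:R `^ b <= \sum_(1 <= j < M.+1) (j%:R : R) `^ (b - 1).
Proof.
move=> b0; have [b1|b1] := leP b 1%R.
  exists 1%R => // M M0; rewrite mul1r.
  apply: (@le_trans _ _ (\sum_(1 <= j < M.+1) M%:R `^ (b - 1))).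
    by rewrite sumr_const_nat subn1 -[leRHS]mulr_natl mulr_powRB1.
  apply: ler_sum_nat => j /andP[j0 jM].
  rewrite -[(b - 1)]opprB !powRN lef_pV2 ?posrE ?powR_gt0 ?ltr0n //.
  by rewrite ge0_ler_powR ?nnegrE ?subr_ge0 // ler_nat -ltnS.
exists (2%:R^-1 `^ b); first by rewrite powR_gt0 // invr_gt0.
move=> M M0.
have M2 : (0 <= 2%:R^-1 * M%:R :> R) by rewrite mulr_ge0 ?invr_ge0.
rewrite -powRM ?invr_ge0 //.
pose h := (M.+1)./2.
apply: (@le_trans _ _ (\sum_(h <= j < M.+1) (j%:R : R) `^ (b - 1))); last first.
  rewrite [leRHS](@big_cat_nat _ _ _ h) //=; last first.
  - by rewrite /h -divn2 leq_div.
  - by rewrite /h -divn2 divn_gt0.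
  by rewrite lerDr sumr_ge0 // => j _; rewrite powR_ge0.
have hE : h.*2 = (M.+1 - odd M.+1)%N.
  by rewrite -[X in (X - _)%N](odd_double_half M.+1) addKn.
have Mh : (M <= h.*2)%N by rewrite hE; case: odd; rewrite ?subSS ?subn0.
have hM : (h.*2 <= M.+1)%N by rewrite hE leq_subr.
apply: (@le_trans _ _ (\sum_(h <= j < M.+1) (2%:R^-1 * M%:R) `^ (b - 1))).
  rewrite sumr_const_nat -[leRHS]mulr_natl -(mulr_powRB1 M2 b0).
  rewrite ler_wpM2r ?powR_ge0 // mulrC ler_pdivrMr // -natrM ler_nat muln2.
  rewrite doubleB -addnn leq_subRL; last by rewrite (leq_trans hM) // leq_addr.
  by rewrite (leq_trans (leq_add hM (leqnn M))) // addSnnS leq_add.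
apply: ler_sum_nat => j /andP[hj jM].
apply: ge0_ler_powR; rewrite ?nnegrE ?subr_ge0 ?(ltW b1) //.
rewrite mulrC ler_pdivrMr // -natrM ler_nat muln2.
by rewrite (leq_trans Mh) // leq_double.
Qed.

Local Open Scope ereal_scope.

(** * Rearrangements and Lorentz norms of finitely supported sequences *)

Lemma card_level_set (R : realType) (u : R^nat) N (l : R) k :
  (0 <= l)%R -> (forall i, (N <= i)%N -> u i = 0%R) ->
  ([set i | (l < `|u i|)%R] #<= `I_k)%card =
  (#|[pred i : 'I_N | (l < `|u i|)%R]| <= k)%N.
Proof.
move=> l0 uN; set P := [pred i : 'I_N | _].
have -> : [set i | (l < `|u i|)%R] = [set` [fset val i | i in P]%fset].
  apply/seteqP; split => i /=.
    move=> li; have iN : (i < N)%N.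
      rewrite ltnNge; apply/negP => /uN ui0.
      by rewrite ui0 normr0 ltNge l0 in li.
    by apply/imfsetP; exists (Ordinal iN).
  by case/imfsetP => j jP ->.
have cP : #|` [fset val i | i in P]%fset| = #|P|.
  by rewrite card_imfset //= ?cardE //; exact: val_inj.
by move/card_eq_fsetP : cP => /card_le_eql ->; rewrite card_le_II.
Qed.

Lemma rearrangement_le (R : realType) (u : R^nat) N (l : R) j :
  (0 <= l)%R -> (forall i, (N <= i)%N -> u i = 0%R) ->
  (#|[pred i : 'I_N | (l < `|u i|)%R]| < j)%N -> rearrangement u j <= l%:E.
Proof.
move=> l0 uN cj; apply: ereal_inf_lbound; exists l => //; split => //.
by rewrite (card_level_set _ l0 uN); case: j cj.
Qed.

Lemma le_rearrangement (R : realType) (u : R^nat) N (l : R) j :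
  (0 <= l)%R -> (0 < j)%N -> (forall i, (N <= i)%N -> u i = 0%R) ->
  (j <= #|[pred i : 'I_N | (l < `|u i|)%R]|)%N -> l%:E <= rearrangement u j.
Proof.
move=> l0 j0 uN jc; apply: le_ereal_inf_tmp => _ [l' [l'0 +] <-].
rewrite (card_level_set _ l'0 uN) lee_fin => c'.
rewrite leNgt; apply/negP => l'l.
suff : (j <= j.-1)%N by rewrite -ltnS prednK // ltnn.
apply: (leq_trans jc); apply: leq_trans c'; apply: subset_leq_card.
by apply/fintype.subsetP => i; rewrite !inE; exact: lt_trans.
Qed.

Lemma rearrangement_ge0 (R : realType) (u : R^nat) j : 0 <= rearrangement u j.
Proof. by apply: le_ereal_inf_tmp => _ [l [l0 _] <-]; rewrite lee_fin. Qed.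

Lemma lorentz_term_ge0 (R : realType) (p s : R) (u : R^nat) j :
  0 <= (j%:R `^ (s / p - 1))%R%:E * rearrangement u j `^ s.
Proof. by rewrite mule_ge0 ?poweR_ge0 // lee_fin powR_ge0. Qed.

Lemma le_poweR (R : realType) (s : R) (x y : \bar R) :
  (0 <= s)%R -> 0 <= x -> x <= y -> x `^ s <= y `^ s.
Proof.
move=> s0 x0 xy; apply: gt0_ler_poweR => //; rewrite in_itv /= leey andbT //.
exact: le_trans xy.
Qed.

(** A rearrangement supported on j <= N that decays more slowly than j^(-1/p)
there has a norm dominated by its values at j of order N: the weighted sum has
the exponent s (1/p - a) - 1 > -1. *)
Lemma lorentz_norm_le (R : realType) (p s a : R) :
  (0 < p)%R -> (0 < s)%R -> (a < p^-1)%R ->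
  exists2 C : R, (0 < C)%R & forall (u : R^nat) N (D : R), (0 <= D)%R ->
    (forall j, (0 < j <= N)%N ->
       rearrangement u j <= (D * j%:R `^ (- a))%R%:E) ->
    (forall j, (N < j)%N -> rearrangement u j <= 0) ->
    lorentz_norm p s%:E u <= (C * D * N%:R `^ (p^-1 - a))%R%:E.
Proof.
move=> p0 s0 ap.
have g0 : (0 < s * (p^-1 - a))%R by rewrite mulr_gt0 ?subr_gt0.
have [C C0 sumC] := sum_powR_ub g0.
exists (C `^ s^-1)%R; first by rewrite powR_gt0.
move=> u N D D0 uD uN.
have sV0 : (s * s^-1 = 1)%R by rewrite divff ?gt_eqF.
have -> : (C `^ s^-1 * D * N%:R `^ (p^-1 - a) =
    (D `^ s * (C * N%:R `^ (s * (p^-1 - a)))) `^ s^-1)%R.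
  rewrite !powRM ?powR_ge0 ?mulr_ge0 ?powR_ge0 ?ltW // -!powRrM sV0 powRr1 //.
  by rewrite [(s * _ * s^-1)%R]mulrAC sV0 mul1r mulrCA mulrA.
rewrite /lorentz_norm -poweR_EFin; apply: le_poweR.
- by rewrite invr_ge0 ltW.
- by apply: nneseries_ge0 => j _ _; exact: lorentz_term_ge0.
rewrite (@nneseries_split _ _ 1 N) => [|j _]; last exact: lorentz_term_ge0.
rewrite [X in _ + X]eseries0 => [|j jN _]; last first.
  have -> : rearrangement u j = 0.
    by apply/eqP; rewrite eq_le rearrangement_ge0 uN // -add1n.
  by rewrite poweR0r ?mule0 // gt_eqF.
rewrite adde0 add1n.
apply: (@le_trans _ _ (\sum_(1 <= j < N.+1)
    (D `^ s * j%:R `^ (s * (p^-1 - a) - 1))%R%:E)).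
  rewrite !big_nat; apply: lee_sum => j /andP[j0 jN].
  have jD := uD j; rewrite j0 -ltnS jN in jD.
  have := le_poweR (ltW s0) (rearrangement_ge0 u j) (jD isT).
  move/(lee_wpmul2l (_ : 0 <= (j%:R `^ (s / p - 1))%R%:E)).
  rewrite lee_fin powR_ge0 => /(_ isT)/le_trans; apply.
  rewrite poweR_EFin -EFinM lee_fin powRM ?powR_ge0 // -powRrM mulrCA.
  rewrite -powRD; last by rewrite pnatr_eq0 -lt0n j0 implybT.
  rewrite le_eqVlt; apply/orP; left; apply/eqP; congr (_ * _ `^ _)%R; ring.
by rewrite sumEFin lee_fin -mulr_sumr ler_wpM2l ?powR_ge0 // mulrC.
Qed.

(** The norm of t times the indicator of M points is of order t M^(1/p),
whatever the second index. *)
Lemma le_lorentz_norm (R : realType) (p : R) (r : \bar R) :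
  (0 < p)%R -> 0 < r ->
  exists2 C : R, (0 < C)%R & forall (u : R^nat) M (t : R),
    (0 <= t)%R -> (0 < M)%N ->
    (forall j, (0 < j <= M)%N -> t%:E <= rearrangement u j) ->
    (C * t * M%:R `^ p^-1)%R%:E <= lorentz_norm p r u.
Proof.
move=> p0; case: r => [s|_|//]; last first.
  exists 1%R => // u M t t0 M0 tu; rewrite mul1r mulrC EFinM.
  apply: le_ereal_sup_tmp; exists ((M%:R `^ p^-1)%R%:E * rearrangement u M).
    by exists M.
  by apply: lee_wpmul2l; rewrite ?lee_fin ?powR_ge0 // tu // M0 leqnn.
rewrite lte_fin => s0.
have b0 : (0 < s / p)%R by rewrite divr_gt0.
have [C C0 sumC] := sum_powR_lb b0.
exists (C `^ s^-1)%R; first by rewrite powR_gt0.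
move=> u M t t0 M0 tu.
have sV0 : (s * s^-1 = 1)%R by rewrite divff ?gt_eqF.
have -> : (C `^ s^-1 * t * M%:R `^ p^-1 =
    (t `^ s * (C * M%:R `^ (s / p))) `^ s^-1)%R.
  rewrite !powRM ?powR_ge0 ?mulr_ge0 ?powR_ge0 ?ltW // -!powRrM sV0 powRr1 //.
  by rewrite [(s * _ * s^-1)%R]mulrAC sV0 mul1r mulrCA mulrA.
rewrite /lorentz_norm -poweR_EFin; apply: le_poweR.
- by rewrite invr_ge0 ltW.
- by rewrite lee_fin mulr_ge0 ?powR_ge0 // mulr_ge0 ?powR_ge0 ?ltW.
apply: le_trans (nneseries_lim_ge M.+1 (fun j _ _ => lorentz_term_ge0 p s u j)).
apply: (@le_trans _ _ (\sum_(1 <= j < M.+1)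
    (t `^ s * j%:R `^ (s / p - 1))%R%:E)).
  by rewrite sumEFin lee_fin -mulr_sumr ler_wpM2l ?powR_ge0 ?sumC.
rewrite !big_nat; apply: lee_sum => j /andP[j0 jN].
rewrite mulrC EFinM; apply: lee_wpmul2l; first by rewrite lee_fin powR_ge0.
rewrite -poweR_EFin; apply: le_poweR; rewrite ?lee_fin ?(ltW s0) //.
by apply: tu; rewrite j0 -ltnS.
Qed.

(** * Lorentz norms of Rademacher sums *)

Definition rademacher_seq (R : realType) n (k : 'I_n) : R^nat :=
  fun i => if (i < 2 ^ n)%N then rademacher R k i else 0%R.

Lemma rademacher_combE (R : realType) n (c : 'I_n -> R) i :
  (\sum_(k < n) c k *: rademacher_seq R k)%R i =
  if (i < 2 ^ n)%N then rademacher_sum c i else 0%R.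
Proof.
rewrite fct_sumE /rademacher_seq /rademacher_sum.
case: ifP => i2n.
  by apply: eq_bigr => k _; rewrite -[LHS]/(c k * _)%R i2n.
by rewrite big1 // => k _; rewrite -[LHS]/(c k * _)%R i2n mulr0.
Qed.

Lemma rademacher_comb_eq0 (R : realType) n (c : 'I_n -> R) i : (2 ^ n <= i)%N ->
  (\sum_(k < n) c k *: rademacher_seq R k)%R i = 0%R.
Proof. by rewrite rademacher_combE ltnNge => ->. Qed.

Lemma rademacher_comb_ord (R : realType) n (c : 'I_n -> R) (i : 'I_(2 ^ n)) :
  (\sum_(k < n) c k *: rademacher_seq R k)%R (i : nat) = rademacher_sum c i.
Proof. by rewrite rademacher_combE ltn_ord. Qed.

(** A vanishing combination has a vanishing second moment 2^n sum_k c_k^2. *)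
Lemma rademacher_lin_indep (R : realType) n : lin_indep (@rademacher_seq R n).
Proof.
move=> c c0.
have /eqP : (\sum_(i < 2 ^ n) rademacher_sum c i ^+ 2 = 0)%R.
  by rewrite big1 // => i _; rewrite -rademacher_comb_ord c0 expr0n.
rewrite sum_rademacher_sum_sqr mulf_eq0 pnatr_eq0 expn_eq0 /=.
rewrite psumr_eq0 => [/allP c20 k|k _]; last exact: sqr_ge0.
by have /eqP/eqP := c20 k (mem_index_enum k); rewrite sqrf_eq0 => /eqP.
Qed.

Lemma lorentz_norm_rademacher_le (R : realType) (p s : R) :
  (0 < p)%R -> (0 < s)%R ->
  exists2 C : R, (0 < C)%R & forall n (c : 'I_n -> R),
    lorentz_norm p s%:E (\sum_(k < n) c k *: rademacher_seq R k)%R <=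
    (C * ((2 ^ n)%:R `^ p^-1 * Num.sqrt (\sum_(k < n) c k ^+ 2)))%R%:E.
Proof.
(* 2k is a moment of order greater than p. *)
move=> p0 s0; pose k := (Num.truncn p).+1; pose a := (k.*2%:R^-1 : R)%R.
have k2p : (p < k.*2%:R)%R.
  by rewrite (lt_le_trans (truncnS_gt p)) // ler_nat -addnn leq_addr.
have a0 : (0 < a)%R by rewrite invr_gt0.
have ap : (a < p^-1)%R by rewrite ltf_pV2 ?posrE.
have [C C0 normC] := lorentz_norm_le p0 s0 ap.
pose K := (k.*2`!%:R : R)%R.
have K0 : (0 < K)%R by rewrite ltr0n fact_gt0.
exists (C * K `^ a)%R; first by rewrite mulr_gt0 ?powR_gt0.
move=> n c; set f := (\sum_(k < n) _)%R; set A := (\sum_(k < n) c k ^+ 2)%R.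
set N := (2 ^ n)%N.
have fN i : (N <= i)%N -> f i = 0%R by exact: rademacher_comb_eq0.
have fE (i : 'I_N) : f i = rademacher_sum c i by exact: rademacher_comb_ord.
have N0 : (0 < N%:R :> R)%R by rewrite ltr0n expn_gt0.
have A0 : (0 <= A)%R by apply: sumr_ge0 => j _; exact: sqr_ge0.
have D0 : (0 <= (K * N%:R) `^ a * Num.sqrt A)%R.
  by rewrite mulr_ge0 ?powR_ge0 ?sqrtr_ge0.
have powa (x : R) : (0 <= x -> (x `^ a) ^+ k.*2 = x)%R.
  move=> x0; rewrite -powR_mulrn ?powR_ge0 //.
  by rewrite -powRrM mulVf ?pnatr_eq0 // powRr1.
apply: le_trans (normC f N _ D0 _ _) _.
- move=> j /andP[j0 jN]; apply: (@rearrangement_le _ _ N) => //.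
    by rewrite mulr_ge0 ?powR_ge0.
  apply: (@count_lt_of_sum_pow _ _ _ _ k) => //.
    by rewrite mulr_ge0 ?powR_ge0.
  under eq_bigr do rewrite fE.
  apply: le_trans (sum_rademacher_sum_even_pow c k) _.
  rewrite !exprMn powa ?mulr_ge0 ?(ltW K0) // powRN exprVn powa //.
  rewrite -[(Num.sqrt A ^+ _)%R](_ : A ^+ k = _)%R; last first.
    by rewrite -mul2n exprM sqr_sqrtr.
  rewrite [leRHS]mulrC mulfVK //.
  by rewrite pnatr_eq0 -lt0n.
- move=> j Nj; apply: (@rearrangement_le _ _ N) => //.
  by rewrite (leq_ltn_trans (max_card _)) // card_ord.
rewrite lee_fin le_eqVlt powRM ?(ltW K0) //; apply/orP; left; apply/eqP.
have -> : (N%:R `^ p^-1 = N%:R `^ a * N%:R `^ (p^-1 - a) :> R)%R.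
  by rewrite -powRD ?(gt_eqF N0) ?implybT // addrC subrK.
by ring.
Qed.

Lemma le_lorentz_norm_rademacher (R : realType) (p : R) (r : \bar R) :
  (0 < p)%R -> 0 < r ->
  exists2 C : R, (0 < C)%R & forall n (c : 'I_n -> R),
    (C * ((2 ^ n)%:R `^ p^-1 * Num.sqrt (\sum_(k < n) c k ^+ 2)))%R%:E <=
    lorentz_norm p r (\sum_(k < n) c k *: rademacher_seq R k)%R.
Proof.
move=> p0 r0; have [C C0 normC] := le_lorentz_norm p0 r0.
exists (C / 2%:R * 48%:R^-1 `^ p^-1)%R.
  by rewrite !mulr_gt0 ?powR_gt0 ?invr_gt0.
move=> n c; set f := (\sum_(k < n) _ *: _)%R.
set A := (\sum_(k < n) c k ^+ 2)%R.
set N := (2 ^ n)%N.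
have fN i : (N <= i)%N -> f i = 0%R by exact: rademacher_comb_eq0.
have fE (i : 'I_N) : f i = rademacher_sum c i by exact: rademacher_comb_ord.
have A0 : (0 <= A)%R by apply: sumr_ge0 => j _; exact: sqr_ge0.
(* The level set of the strict inequality below is empty when A = 0. *)
have := sqrtr_ge0 A; rewrite le_eqVlt => /orP[/eqP <-|sA0].
  rewrite !mulr0; have := normC f 1%N 0%R (lexx _) isT.
  rewrite mulr0 mul0r; apply => j _; exact: rearrangement_ge0.
set M := #|[pred i : 'I_N | (Num.sqrt A / 2%:R < `|f i|)%R]|.
have NM : (N%:R <= 48%:R * M%:R :> R)%R.
  apply: paley_zygmund_count => //.
    under eq_bigr do rewrite fE.
    by rewrite sum_rademacher_sum_sqr sqr_sqrtr.
  under eq_bigr do rewrite fE.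
  apply: le_trans (sum_rademacher_sum_even_pow c 2) _.
  by rewrite [(Num.sqrt A ^+ 4)%R](exprM _ 2 2) sqr_sqrtr.
have M0 : (0 < M)%N.
  rewrite lt0n; apply: contraTneq NM => ->.
  by rewrite mulr0 -ltNge ltr0n expn_gt0.
have t0 : (0 <= Num.sqrt A / 2%:R)%R by rewrite divr_ge0 ?sqrtr_ge0.
apply: le_trans (normC f M _ t0 M0 _); last first.
  by move=> j /andP[j0 jM]; exact: (@le_rearrangement _ _ N).
rewrite lee_fin.
rewrite [leLHS](_ : _ = C * (Num.sqrt A / 2%:R) *
   (48%:R^-1 `^ p^-1 * N%:R `^ p^-1))%R; last by ring.
rewrite ler_wpM2l ?mulr_ge0 ?(ltW C0) // -powRM ?invr_ge0 //.
by rewrite ge0_ler_powR ?nnegrE ?mulr_ge0 ?invr_ge0 ?(ltW p0) // ler_pdivrMl.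
Qed.

Theorem theorem4p6 (R : realType) (p : R) (q r : \bar R)
    (hp : (0 < p)%R) (hq : 0 < q) (hqr : q < r) :
  exists2 alpha : R, (0 < alpha)%R &
    forall n : nat, (1 <= n)%N ->
      alpha%:E <= bernstein (lorentz p q) (lorentz_norm p q) (lorentz_norm p r)
                    (idfun : R^nat -> R^nat) n.
Proof.
case: q hq hqr => [s|_|]//; last by rewrite ltNge leey.
rewrite lte_fin => s0 sr.
have r0 : 0 < r by apply: lt_trans sr; rewrite lte_fin.
have [C1 C10 ub] := lorentz_norm_rademacher_le hp s0.
have [C2 C20 lb] := le_lorentz_norm_rademacher hp r0.
exists (C2 / C1)%R; first by rewrite divr_gt0.
move=> n _; apply: le_ereal_sup_tmp.
exists (ereal_inf [set lorentz_norm p r (idfun f) | f in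
  [set f | lin_span (@rademacher_seq R n) f /\ lorentz_norm p s%:E f = 1]]).
  exists (lin_span (@rademacher_seq R n)) => //; split.
    by exists (@rademacher_seq R n) => //; exact: rademacher_lin_indep.
  by move=> _ [c ->]; exact: le_lt_trans (ub n c) (ltry _).
apply: le_ereal_inf_tmp => _ [_ [[c ->] normq] <-] /=.
apply: le_trans (lb n c); have := ub n c; rewrite normq !lee_fin => ub1.
by rewrite ler_wpM2l ?(ltW C20) // -[leLHS]mulr1 ler_pdivrMl.
Qed.
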